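(* (1) Two elements of the taiga monoid ${\mathsf{taig}}$ lie in the same connected component of $K({\mathsf{taig}})$ if and only if they have the same evaluation. (2) For every $n\ge1$, every connected component of $K({\mathsf{taig}}_n)$ has diameter at most $n$, and some connected component has diameter at least $n-1$; hence the maximum diameter of a connected component of $K({\mathsf{taig}}_n)$ is $n-1$ or $n$.
   Context: Let $\mathcal{A}=\{1<2<3<\cdots\}$ be the ordered alphabet of positive integers and $\mathcal{A}_n=\{1<2<\cdots<n\}$. For a monoid $M$ and $s,t\in M$, write $s\sim t$ if there exist $x,y\in M$ with $s=xy$ and $t=yx$ (a cyclic shift); $\sim^*$ is the reflexive–transitive closure of $\sim$. The cyclic shift graph $K(M)$ is the undirected graph with vertex set $M$ and an edge between $s$ and $t$ iff $s\sim t$; its connected components are the $\sim^*$-classes, and distances/diameters are graph distances in $K(M)$. The evaluation of a word $w$ is the tuple $(|w|_a)_{a}$ giving the number of occurrences of each letter $a$; all monoids considered are defined by presentations whose defining relations preserve evaluation, so the evaluation of an element is well defined, and $s\equiv_{\mathrm{ev}} t$ means $s$ and $t$ have the same evaluation. The taiga monoid ${\mathsf{taig}}$ is $\mathcal{A}^*$ modulo the congruence generated by the relations $cavb=acvb$ (letters $a\le b<c$, $v\in\mathcal{A}^*$) together with $bavb=abvb$ (letters $a,b$, $v\in\mathcal{A}^*$); ${\mathsf{taig}}_n$ is defined by the same relations restricted to $\mathcal{A}_n$. Equivalently, two words are equal in ${\mathsf{taig}}$ iff right-to-left insertion of their letters into a binary search tree with multiplicities (each label occurs at most once, left subtree labels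 smaller, right subtree labels larger, and inserting an existing label increments its multiplicity) gives the same tree. *)

(* Defs.v *)
From Stdlib Require Import Relations.Relation_Operators.
From mathcomp Require Import all_boot.
Set Implicit Arguments. Unset Strict Implicit. Unset Printing Implicit Defensive.

Definition alphA : pred nat := fun a => 0 < a.
Definition alphAn (n : nat) : pred nat := fun a => 0 < a <= n.

Definition taig_rel (P : pred nat) (l r : seq nat) : Prop :=
  (exists a b c v, [/\ [&& P a, P b, P c & a <= b < c], all P v,
       l = [:: c; a] ++ v ++ [:: b] & r = [:: a; c] ++ v ++ [:: b]])
  \/ (exists a b v, [/\ P a, P b, all P v,
       l = [:: b; a] ++ v ++ [:: b] & r = [:: a; b] ++ v ++ [:: b]]).

Definition taig_step (P : pred nat) (u w : seq nat) : Prop :=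
  exists p q l r, [/\ taig_rel P l r, all P p, all P q,
                      u = p ++ l ++ q & w = p ++ r ++ q].

Definition taig_eq (P : pred nat) : seq nat -> seq nat -> Prop :=
  clos_refl_sym_trans (seq nat) (taig_step P).

Definition cyc (P : pred nat) (s t : seq nat) : Prop :=
  exists x y, [/\ all P x, all P y, taig_eq P s (x ++ y) & taig_eq P t (y ++ x)].

Definition cyc_star (P : pred nat) : seq nat -> seq nat -> Prop :=
  clos_refl_trans (seq nat) (cyc P).

(* within P k s t : the distance between (the elements represented by) s and t
   in the cyclic shift graph K(M) is at most k. *)
Fixpoint within (P : pred nat) (k : nat) (s t : seq nat) : Prop :=
  match k with
  | 0 => taig_eq P s t
  | k'.+1 => exists u, cyc P s u /\ within P k' u t
  end.

Definition same_ev (s t : seq nat) : Prop := forall a, count_mem a s = count_mem a t.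

(* Main.v *)
(* An element of the taiga monoid is a multiset of letters together with the
   search tree of the last occurrences, since all other occurrences move freely;
   so one works with repetition-free words.

   Upper bound. Let [u] be the left-to-right postfix reading of the target tree.
   Process the letters [x] of [u] in order: one cyclic shift moves the whole
   subtree of [x] to the end of the word, so that [x] becomes the root. An
   invariant on the ancestor relation shows that the subtrees of the target
   already built are never destroyed, so after all letters of [u] the target is
   reached.

   Lower bound. On permutations of 1, ..., n the number of [a] such that [a + 1]
   precedes [a] is an invariant of the monoid element and changes by at most one
   under a cyclic shift; it is 0 on 1 2 ... n and n - 1 on n ... 2 1. *)
Require Import Defs.
From Stdlib Require Import Relations.Relation_Operators.
From mathcomp Require Import all_boot zify.
Set Implicit Arguments. Unset Strict Implicit. Unset Printing Implicit Defensive.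

Lemma mem_first_split (T : eqType) (a : T) t : a \in t ->
  exists t1 t2, t = t1 ++ a :: t2 /\ a \notin t1.
Proof.
elim: t => // c t IH; rewrite inE; case: eqP => [-> _|ac /IH[t1 [t2 [-> at1]]]].
  by exists [::], t.
by exists (c :: t1), t2; rewrite inE negb_or at1; split=> //; rewrite andbT; apply/eqP.
Qed.

(** * Commutation rules in the taiga congruence *)

Section Congruence.
Variable P : pred nat.
Implicit Types p q s t w : seq nat.

Lemma taig_refl s : taig_eq P s s.
Proof. exact: rst_refl. Qed.

Lemma taig_sym s t : taig_eq P s t -> taig_eq P t s.
Proof. exact: rst_sym. Qed.

Lemma taig_trans s t w : taig_eq P s t -> taig_eq P t w -> taig_eq P s w.
Proof. exact: rst_trans. Qed.

Lemma taig_ctx p q s t : all P p -> all P q ->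
  taig_eq P s t -> taig_eq P (p ++ s ++ q) (p ++ t ++ q).
Proof.
move=> Pp Pq; elim=> {s t}.
- move=> s t [p1 [q1 [l [r [lr Pp1 Pq1 -> ->]]]]]; apply: rst_step.
  exists (p ++ p1), (q1 ++ q), l, r.
  by split; rewrite ?all_cat ?Pp ?Pp1 ?Pq ?Pq1 // -!catA.
- by move=> s; apply: taig_refl.
- by move=> s t _; apply: taig_sym.
- by move=> s t w _ st _; apply: taig_trans.
Qed.

Lemma taig_catl p s t : all P p -> taig_eq P s t -> taig_eq P (p ++ s) (p ++ t).
Proof. by move=> Pp /(taig_ctx Pp (q := [::]) isT); rewrite !cats0. Qed.

Lemma taig_cons a s t : P a -> taig_eq P s t -> taig_eq P (a :: s) (a :: t).
Proof. by move=> Pa; apply: (@taig_catl [:: a]); rewrite /= Pa. Qed.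

Lemma taig_catr q s t : all P q -> taig_eq P s t -> taig_eq P (s ++ q) (t ++ q).
Proof. by move=> Pq; apply: (@taig_ctx [::] q). Qed.

Lemma taig_rel_perm l r : taig_rel P l r -> perm_eq l r.
Proof.
by case=> [[a [b [c [v [_ _ -> ->]]]]]|[a [b [v [_ _ _ -> ->]]]]];
  rewrite perm_cat2r (perm_catC [:: _] [:: _]).
Qed.

Lemma taig_perm s t : taig_eq P s t -> perm_eq s t.
Proof.
elim=> {s t}.
- move=> s t [p [q [l [r [lr _ _ -> ->]]]]].
  by rewrite perm_cat2l perm_cat2r taig_rel_perm.
- by move=> s.
- by move=> s t _; rewrite perm_sym.
- by move=> s t w _ st _; apply: perm_trans.
Qed.

(* Both families of relations say that neighbours commute as soon as some
   later letter lies between them, endpoints included. *)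
Definition sep (r : seq nat) (a c : nat) : bool :=
  has (fun b => minn a c <= b <= maxn a c) r.

Lemma taig_swap_lt a c r : P a -> P c -> all P r -> a < c -> sep r a c ->
  taig_eq P [:: c, a & r] [:: a, c & r].
Proof.
move=> Pa Pc Pr ac /hasP[b br abc].
have [v [w [rE _]]] := mem_first_split br.
move: Pr; rewrite rE all_cat /= => /and3P[Pv Pb Pw].
(* The separator [b] lies in the interval from [a] to [c]: below [c] the first family of relations
   applies, at [b = c] the second. *)
case: (ltnP b c) => bc.
  apply: rst_step; exists [::], w, ([:: c; a] ++ v ++ [:: b]), ([:: a; c] ++ v ++ [:: b]).
  split=> //; last 2 first; [by rewrite /= -catA | by rewrite /= -catA |].
  by left; exists a, b, c, v; split=> //; rewrite Pa Pb Pc /=; lia.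
have -> : b = c by lia.
apply: rst_step; exists [::], w, ([:: c; a] ++ v ++ [:: c]), ([:: a; c] ++ v ++ [:: c]).
split=> //; last 2 first; [by rewrite /= -catA | by rewrite /= -catA |].
by right; exists a, c, v.
Qed.

Lemma taig_swap a c r : P a -> P c -> all P r -> sep r a c ->
  taig_eq P [:: c, a & r] [:: a, c & r].
Proof.
move=> Pa Pc Pr sr; case: (ltngtP a c) => [ac|ca|->]; last exact: taig_refl.
  exact: taig_swap_lt.
by apply: taig_sym; apply: taig_swap_lt => //; rewrite /sep minnC maxnC.
Qed.

(** The letter [c] passes the letters of [m] one at a time; the separators come from [n], which
    stays to its right throughout. *)
Lemma taig_move c m n : P c -> all P m -> all P n ->
  (forall a, a \in m -> sep n a c) -> taig_eq P (c :: m ++ n) (m ++ c :: n).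
Proof.
move=> Pc + Pn; elim: m => [|a m IH] /= Pm sepm; first exact: taig_refl.
case/andP: Pm => Pa Pm.
apply: (@taig_trans _ [:: a, c & m ++ n]).
  apply: taig_swap => //; first by rewrite all_cat Pm.
  by rewrite /sep has_cat; apply/orP; right; apply: sepm; rewrite inE eqxx.
by apply: taig_cons => //; apply: IH => // b bm; apply: sepm; rewrite inE bm orbT.
Qed.

(** [undup] keeps last occurrences. The first letter [a] of [s] is matched with its first occurrence
    in [t], which is moved to the front. *)
Lemma taig_undup s t : all P s -> perm_eq s t -> undup s = undup t ->
  taig_eq P s t.
Proof.
elim: s t => [|a s IH] t /=.
  by move=> _; rewrite perm_sym => /perm_nilP -> _; apply: taig_refl.
case/andP=> Pa Ps st; have Pt : all P t by rewrite -(perm_all _ st) /= Pa.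
have at_ : a \in t by rewrite -(perm_mem st) inE eqxx.
have [t1 [t2 [tE at1]]] := mem_first_split at_.
move: st Pt; rewrite tE => st; rewrite all_cat /= => /and3P[Pt1 _ Pt2].
have st' : perm_eq s (t1 ++ t2).
  by move: st; rewrite perm_sym perm_catC /= perm_cons perm_catC perm_sym.
have mv : (forall c, c \in t1 -> sep t2 c a) -> undup s = undup (t1 ++ t2) ->
    taig_eq P (a :: s) (t1 ++ a :: t2).
  move=> sept us; apply: (@taig_trans _ (a :: t1 ++ t2)); last exact: taig_move.
  by apply: taig_cons => //; apply: IH.
(* If [a] recurs, its later copy separates the moved one from every neighbour. *)
case: ifP => as_ us.
  have at2 : a \in t2.
    by move: as_; rewrite (perm_mem st') mem_cat (negbTE at1).
  apply: mv => [c ct1|]; first by apply/hasP; exists a => //; lia.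
  rewrite us !undup_cat /= at2; congr (_ ++ _); apply: eq_in_filter => c _.
  by rewrite inE; case: eqP => // ->; rewrite at2.
have at2 : a \notin t2.
  by move: as_; rewrite (perm_mem st') mem_cat (negbTE at1) /= => ->.
move: us; rewrite !undup_cat /= (negbTE at2).
(* Otherwise [a] heads [undup t], so every letter [c] of [t1] recurs in [t2], and this later copy
   separates [c] from [a]. *)
case E : [seq _ <- _ | _] => [|c r] /=; last first.
  case=> ac _; have : c \in c :: r by rewrite inE eqxx.
  by rewrite -E mem_filter -ac inE eqxx.
have t12 c : c \in t1 -> c \in t2.
  move=> ct1; have : c \notin [::] by [].
  rewrite -E mem_filter mem_undup ct1 andbT negbK inE => /orP[/eqP ca|//].
  by move: at1; rewrite -ca ct1.
case=> us; apply: mv => [c ct1|]; first by apply/hasP; exists c; [exact: t12|lia].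
rewrite us undup_cat; have -> // : [seq x <- undup t1 | x \notin t2] = [::].
apply/eqP; rewrite -(negbK (_ == _)) -has_filter; apply/hasPn => c.
by rewrite mem_undup => /t12 ->.
Qed.

(** Induction from the right: a first letter [c] outside [m] crosses the whole block of [m]-letters
    of the sorted tail. Its separators must lie outside [m], so as to be still to the right of that
    block. *)
Lemma taig_partition (m : pred nat) w : all P w -> uniq w ->
  (forall a c, a \in w -> c \in w -> m a -> ~~ m c -> index c w < index a w ->
     exists b, [/\ b \in w, ~~ m b, index c w < index b w &
                   minn a c <= b <= maxn a c]) ->
  taig_eq P w (filter m w ++ filter (predC m) w).
Proof.
elim: w => [|c w IH] /=; first by move=> *; apply: taig_refl.
case/andP=> Pc Pw /andP[cw uw] H.
have nc z : z \in w -> (c == z) = false.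
  by move=> zw; apply/eqP => cz; rewrite cz zw in cw.
have IHw : taig_eq P w (filter m w ++ filter (predC m) w).
  apply: IH => // a d aw dw ma md da.
  have aw' : a \in c :: w by rewrite inE aw orbT.
  have dw' : d \in c :: w by rewrite inE dw orbT.
  have := H a d aw' dw' ma md; rewrite !nc // ltnS => /(_ da)[b []].
  rewrite inE => /predU1P[->|bw] mb; first by rewrite eqxx.
  by rewrite nc // ltnS => db abd; exists b.
case mc : (m c) => /=; first exact: taig_cons.
apply: (@taig_trans _ (c :: filter m w ++ filter (predC m) w)).
  exact: taig_cons.
apply: taig_move => // [||a].
- by apply/allP => z; rewrite mem_filter => /andP[_ /(allP Pw)].
- by apply/allP => z; rewrite mem_filter => /andP[_ /(allP Pw)].
rewrite mem_filter => /andP[ma aw].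
have aw' : a \in c :: w by rewrite inE aw orbT.
have := H a c aw' (mem_head c w) ma (negbT mc).
rewrite eqxx nc // => /(_ isT)[b []].
rewrite inE => /predU1P[->|bw] mb; first by rewrite ?eqxx.
by move=> _ abc; apply/hasP; exists b => //; rewrite mem_filter /= mb.
Qed.

End Congruence.

(** * Subtrees of a search tree, and raising one by a cyclic shift *)

Lemma index_filter_lt (m : pred nat) w a b : m a -> m b ->
  (index a (filter m w) < index b (filter m w)) = (index a w < index b w).
Proof.
move=> ma mb; elim: w => //= c w IH.
case: ifP => mc /=; first by case: eqP => _; case: eqP => _; rewrite ?ltnS.
have -> : (c == a) = false by apply/eqP => ca; rewrite ca ma in mc.
have -> : (c == b) = false by apply/eqP => cb; rewrite cb mb in mc.
by rewrite ltnS.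
Qed.

Lemma index_partition (m : pred nat) w a b : a \in w -> b \in w ->
  let w' := filter (predC m) w ++ filter m w in
  (index a w' < index b w') =
  (if m a == m b then index a w < index b w else m b).
Proof.
move=> aw bw /=; rewrite !index_cat !mem_filter /= aw bw !andbT.
case ma: (m a); case mb: (m b) => /=.
- by rewrite ltn_add2l index_filter_lt.
- apply/negbTE; rewrite -leqNgt; apply: leq_trans (index_size _ _) _.
  exact: leq_addr.
- by apply: ltn_addr; rewrite index_mem mem_filter /= ma aw.
- by rewrite index_filter_lt //= ?ma ?mb.
Qed.

(* [desc w x a]: [a] lies in the subtree rooted at [x] of the search tree of the
   repetition-free word [w], that is, no letter between [a] and [x] follows [x]. *)
Definition desc (w : seq nat) (x a : nat) : bool :=
  all (fun b => (minn a x <= b <= maxn a x) ==> (index b w <= index x w)) w.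

Lemma descP w x a :
  reflect (forall b, b \in w -> minn a x <= b <= maxn a x -> index b w <= index x w)
          (desc w x a).
Proof.
apply: (iffP allP) => H b bw; first by move=> abx; move: (H b bw); rewrite abx.
by apply/implyP; apply: H.
Qed.

Lemma descPn w x a :
  reflect (exists2 b, b \in w & minn a x <= b <= maxn a x /\ index x w < index b w)
          (~~ desc w x a).
Proof.
apply: (iffP allPn) => -[b bw].
  by rewrite negb_imply -ltnNge => /andP[abx xb]; exists b.
by case=> abx xb; exists b; rewrite // negb_imply abx -ltnNge.
Qed.

(** No letter of the subtree of [x] follows [x], so a letter [x] of [w] ends the new word and thus
    becomes the root. *)
Definition raise (x : nat) (w : seq nat) : seq nat :=
  filter (predC (desc w x)) w ++ filter (desc w x) w.

Section Raise.
Variable P : pred nat.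

Lemma perm_raise x w : perm_eq (raise x w) w.
Proof. by rewrite /raise perm_catC perm_filterC. Qed.

(** A letter [c] outside the subtree of [x] has a blocking letter [b] after [x], between [c] and
    [x]. As [b] does not block a descendant [a], it lies between [a] and [c]; being itself outside
    the subtree, it is the separator required. *)
Lemma taig_desc_partition x w : all P w -> uniq w ->
  taig_eq P w (filter (desc w x) w ++ filter (predC (desc w x)) w).
Proof.
move=> Pw uw; apply: taig_partition => // a c aw cw /descP da /descPn[b bw [cbx xb]] ca.
exists b; split=> //.
- by apply/descPn; exists b => //; split=> //; lia.
- have := da a aw; lia.
have := da b bw; have := da a aw; lia.
Qed.

Lemma undup_cat_sub (e w : seq nat) : uniq w -> {subset e <= w} ->
  undup (e ++ w) = w.
Proof.
move=> uw ew; rewrite undup_cat (undup_id uw).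
have -> // : [seq x <- undup e | x \notin w] = [::].
apply/eqP; rewrite -(negbK (_ == _)) -has_filter; apply/hasPn => c.
by rewrite mem_undup => /ew ->.
Qed.

(** The factors exchanged are the subtree of [x] and the rest of [w]. Each extra copy in [e] joins
    the factor that contains its letter, so [taig_undup] can gather the copies at the front before
    and after the shift. *)
Lemma cyc_raise e x w : all P e -> all P w -> uniq w ->
  {subset e <= w} -> cyc P (e ++ w) (e ++ raise x w).
Proof.
move=> Pe Pw uw ew.
set m := filter (desc w x) w; set n := filter (predC (desc w x)) w.
have umn : uniq (m ++ n) by rewrite (perm_uniq (permEl (perm_filterC _ _))).
have Pmn : all P (m ++ n) by rewrite (perm_all _ (permEl (perm_filterC _ _))).
have mn_w : m ++ n =i w by apply: perm_mem; rewrite perm_filterC.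
have [um mn un] : [/\ uniq m, ~~ has (mem m) n & uniq n] by move: umn; rewrite cat_uniq => /and3P.
pose em := filter (mem m) e; pose en := filter (predC (mem m)) e.
have eE : perm_eq (em ++ en) e by rewrite perm_filterC.
have [Pem Pen] : all P em /\ all P en.
  by move: Pe; rewrite -(perm_all _ eE) all_cat => /andP.
move: (Pmn); rewrite all_cat => /andP[Pm Pn].
have em_m : {subset em <= m} by move=> z; rewrite mem_filter => /andP[].
have en_n : {subset en <= n}.
  move=> z; rewrite mem_filter /= => /andP[zm /ew]; rewrite -mn_w mem_cat.
  by rewrite (negbTE zm).
have undup_blocks (a b c d : seq nat) : uniq (b ++ d) -> {subset a <= b} -> {subset c <= d} ->
    undup ((a ++ b) ++ (c ++ d)) = b ++ d.
  rewrite cat_uniq => /and3P[ub bd ud] ab cd.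
  rewrite undup_cat !undup_cat_sub //; congr (_ ++ _); apply/all_filterP/allP => z zb.
  rewrite mem_cat; apply: contra bd => zcd; apply/hasP; exists z => //.
  by case/orP: zcd => // /cd.
exists (em ++ m), (en ++ n); split; rewrite ?all_cat ?Pem ?Pm ?Pen ?Pn //.
- apply: (@taig_trans _ _ (e ++ m ++ n)).
    exact: taig_catl Pe (taig_desc_partition x Pw uw).
  apply: taig_undup; first by rewrite all_cat Pe.
    rewrite -(perm_cat2r (m ++ n)) in eE; rewrite perm_sym; apply: perm_trans eE.
    by rewrite -!catA perm_cat2l !catA perm_cat2r perm_catC.
  by rewrite undup_blocks // undup_cat_sub // => z /ew; rewrite mn_w.
- have unm : uniq (n ++ m) by rewrite uniq_catC.
  apply: taig_undup; first by rewrite all_cat Pe /= all_cat Pn.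
    rewrite -(perm_cat2r (n ++ m)) in eE; rewrite perm_sym; apply: perm_trans eE.
    by rewrite perm_sym -!catA perm_catCA perm_cat2l perm_catCA.
  by rewrite undup_blocks // undup_cat_sub // => z /ew; rewrite -mn_w !mem_cat orbC.
Qed.

Lemma last_occurrence (p : pred nat) w : uniq w -> has p w ->
  exists b, [/\ b \in w, p b & forall b', b' \in w -> p b' -> index b' w <= index b w].
Proof.
elim: w => //= a w IH /andP[aw uw]; case hw: (has p w); last first.
  rewrite orbF => pa; exists a; split; rewrite ?mem_head // => b'.
  rewrite inE => /predU1P[->|b'w pb'] //.
  by move/negbT/hasPn/(_ _ b'w)/negP: hw.
move=> _; have [b [bw pb bmax]] := IH uw hw; exists b; split; rewrite ?inE ?bw ?orbT //.
have -> : (a == b) = false by apply/eqP => ab; rewrite ab bw in aw.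
move=> b'; rewrite inE => /predU1P[->|b'w pb']; first by rewrite eqxx.
by case: eqP => // _; rewrite ltnS bmax.
Qed.

(* A repetition-free word is determined up to taiga equivalence by the ancestor
   relation of its search tree; one inclusion suffices. *)
Lemma taig_of_desc t u : all P t -> uniq u -> perm_eq t u ->
  (forall w d, w \in u -> d \in u -> desc u w d -> index d t <= index w t) ->
  taig_eq P t u.
Proof.
elim: u t => [|a u IH] t Pt /=.
  by move=> _ /perm_nilP -> _; apply: taig_refl.
case/andP=> au uu tu H.
have ut : uniq t by rewrite (perm_uniq tu) /= au.
have at_ : a \in t by rewrite (perm_mem tu) mem_head.
have [t1 [t2 [tE at1]]] := mem_first_split at_.
move: (Pt) (ut); rewrite {1 2}tE all_cat cat_uniq /=.
case/and3P=> Pt1 Pa Pt2 /and3P[ut1 _ /andP[at2 ut2]].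
have t12E : t1 ++ t2 = filter (predC1 a) t.
  rewrite tE filter_cat /= eqxx /=; congr (_ ++ _); apply/esym/all_filterP/allP.
    by move=> z zt1 /=; apply: contra at1 => /eqP <-.
  by move=> z zt2 /=; apply: contra at2 => /eqP <-.
have nau z : z \in u -> (a == z) = false.
  by move=> zu; apply/eqP => az; rewrite az zu in au.
have {}IH : taig_eq P (t1 ++ t2) u.
  apply: IH => //; first by rewrite all_cat Pt1.
    by move: tu; rewrite tE perm_catC /= perm_cons perm_catC.
  move=> w d wu du /descP dwd.
  rewrite t12E leqNgt index_filter_lt /= ?[_ == a]eq_sym ?nau // -leqNgt.
  apply: H; rewrite ?inE ?wu ?du ?orbT //; apply/descP => b.
  rewrite inE => /predU1P[->|bu] bdw; first by rewrite /= eqxx.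
  by rewrite /= !nau // ltnS; apply: dwd.
rewrite tE; apply: taig_trans (taig_cons Pa IH); apply: taig_sym; apply: taig_move => // c ct1.
have cau : c \in a :: u by rewrite -(perm_mem tu) tE mem_cat ct1.
have uau : uniq (a :: u) by rewrite /= au.
have aE : index a t = size t1 by rewrite tE index_cat (negbTE at1) /= eqxx addn0.
have ca : index c t < index a t by rewrite aE tE index_cat ct1 index_mem.
(* The last letter [b] of [a :: u] between [a] and [c] is an ancestor of [a] there, so the
   hypothesis puts it after [a] in [t], where it separates [a] from [c]. *)
have [b [bau abc bmax]] : exists b, [/\ b \in a :: u, minn a c <= b <= maxn a c &
    forall b', b' \in a :: u -> minn a c <= b' <= maxn a c ->
      index b' (a :: u) <= index b (a :: u)].
  apply: (last_occurrence (p := fun b => minn a c <= b <= maxn a c)) => //.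
  by apply/hasP; exists c => //; rewrite geq_minr leq_maxr.
have ab : index a t <= index b t.
  apply: H => //; first exact: mem_head.
  by apply/descP => d dau adb; apply: bmax => //; clear -abc adb; lia.
have ba : b != a.
  have nac : (a == c) = false by apply/eqP => ac; rewrite -ac ltnn in ca.
  have /(bmax _ cau) : minn a c <= c <= maxn a c by rewrite geq_minr leq_maxr.
  by rewrite /= nac eq_sym; case: eqP.
have : b \in t by rewrite (perm_mem tu).
move: ab; rewrite aE tE index_cat mem_cat inE (negbTE ba).
case: ifP => [bt1|_ _ bt2]; first by rewrite leqNgt index_mem bt1.
by apply/hasP; exists b; rewrite // minnC maxnC.
Qed.

End Raise.

(** * The invariant of the raising process *)

(* Repetition-free words avoiding the pattern 312 are the left-to-right postfix
   readings of search trees. *)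
Definition avoids312 (u : seq nat) : Prop :=
  forall a b c : nat, a \in u -> b \in u -> c \in u -> a < b < c ->
    index c u < index a u -> index b u < index a u.

(* The first [h] letters of [u] are the processed ones. The second and third
   clauses say that the subtrees already built hang on the path of left children
   from the root of [w]: an unprocessed letter above a part of such a subtree is
   greater than its letters and lies above all of it. *)
Definition raise_inv (u : seq nat) (h : nat) (w : seq nat) : Prop :=
  [/\ forall y d, y \in u -> d \in u -> index y u < h -> desc u y d ->
         index d w <= index y w,
      forall y d v, y \in u -> d \in u -> v \in u -> index y u < h ->
         h <= index v u -> desc u y d -> y < d < v -> desc w v d ->
         index y w < index v w,
      forall v d, v \in u -> d \in u -> h <= index v u -> index d u < h ->
         v < d -> ~~ desc w v d
    & forall y d, y \in u -> d \in u -> (index y u).+1 = h ->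
         index d w <= index y w].

Lemma index_inj_in (w : seq nat) a b : a \in w -> index a w = index b w -> a = b.
Proof.
move=> aw ab; have bw : b \in w by rewrite -index_mem -ab index_mem.
by rewrite -(nth_index 0 aw) ab nth_index.
Qed.

(** Raising [x] can change the order of two letters only if exactly one of them lies in the subtree
    of [x]. Each clause is checked on such pairs, while avoidance of 312 restricts the relative
    values of processed and unprocessed letters. *)
Lemma raise_inv_step u h w x : uniq u -> perm_eq w u -> avoids312 u ->
  x \in u -> index x u = h -> raise_inv u h w -> raise_inv u h.+1 (raise x w).
Proof.
move=> uu wu av xu xh [A B B' C].
have memw z : (z \in w) = (z \in u) by rewrite (perm_mem wu).
have memr z : (z \in raise x w) = (z \in u) by rewrite (perm_mem (perm_raise _ _)) memw.
have ord a b : a \in u -> b \in u ->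
    (index a (raise x w) < index b (raise x w)) =
    (if desc w x a == desc w x b then index a w < index b w else desc w x b).
  by move=> au bu; apply: index_partition; rewrite memw.
have mx : desc w x x by apply/descP => b _ bx; have -> : b = x by lia.
have lastx a : a \in u -> index a (raise x w) <= index x (raise x w).
  move=> au; rewrite leqNgt ord // mx; case ma: (desc w x a) => //=.
  by rewrite -leqNgt; apply: (descP _ _ _ ma); rewrite ?memw //; lia.
have ltx a : a \in u -> a != x -> index a (raise x w) < index x (raise x w).
  move=> au ax; rewrite ltn_neqAle lastx // andbT; apply: contra ax => /eqP ax.
  by apply/eqP/(index_inj_in _ ax); rewrite memr.
have sub a b : desc w x a -> minn a x <= b <= maxn a x -> desc w x b.
  by move=> /descP ma ab; apply/descP => c cw bc; apply: ma => //; lia.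
have visx a : a \in u -> index a u < h.+1 -> a != x -> index a u < h.
  move=> au ah ax; rewrite ltn_neqAle -ltnS ah andbT; apply: contra ax.
  by rewrite -xh => /eqP ax; apply/eqP/(index_inj_in au).
(* Let [r] be the last processed letter, the root of [w] by the fourth clause. Avoiding 312 forces
   [x < r < v], so [r] keeps all letters from [r] on outside the subtree of [x], and their order
   survives. *)
have right_free v d : v \in u -> d \in u -> h < index v u -> index d u < h -> x < d < v ->
    ~~ desc (raise x w) v d.
  move=> vu du hv dh /andP[xd dv].
  have h_gt0 : 0 < h by exact: leq_ltn_trans (leq0n _) dh.
  pose r := nth 0 u h.-1.
  have hu : h.-1 < size u.
    by rewrite (leq_ltn_trans (leq_pred h)) // -xh index_mem.
  have ru : r \in u by rewrite mem_nth.
  have rh : (index r u).+1 = h by rewrite index_uniq // prednK.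
  have rmax b : b \in u -> index b w <= index r w by move=> bu; apply: C.
  have rh' : index r u < h by rewrite -rh.
  have rx : r != x by apply/eqP => rx; move: rh'; rewrite rx xh ltnn.
  have xr : x < r.
    rewrite ltnNge; apply/negP => rlex.
    have {}rlex : r < x by rewrite ltn_neqAle rx.
    have := av r x d ru xu du; rewrite rlex xd xh => /(_ isT).
    have dr : d != r by move: rlex xd; clear; lia.
    have drh : index d u < index r u.
      rewrite ltn_neqAle -ltnS rh dh andbT; apply: contra dr => /eqP dr.
      by apply/eqP/(index_inj_in du).
    by move=> /(_ drh); move: rh'; clear; lia.
  have wxr : index x w < index r w.
    rewrite ltn_neqAle rmax // andbT; apply: contra rx => /eqP rx.
    by apply/eqP/esym/(index_inj_in _ rx); rewrite memw.
  have rv : r < v.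
    rewrite ltnNge; apply/negP => vr.
    have nvr : v != r by apply/eqP => vr'; move: hv rh'; rewrite vr'; clear; lia.
    have := av x v r xu vu ru; rewrite xh rh' => H.
    by have := H _ isT; move: hv vr nvr xd dv; clear; lia.
  have blocked b : r <= b -> desc w x b = false.
    move=> rb; apply/negbTE/descPn; exists r; rewrite ?memw //; split=> //.
    by move: rb xr; clear; lia.
  have mv : desc w x v = false by apply: blocked; apply: ltnW.
  (* If [d <= r], then [r] itself blocks [v] from [d]; otherwise [d] lies below [r] in the target
     and the second clause applies. *)
  case: (leqP d r) => dr.
    apply/descPn; exists r; rewrite ?memr //; split; first by move: dr rv; clear; lia.
    rewrite ord // mv blocked //= ltn_neqAle rmax // andbT.
    apply/eqP => vr; have : v = r by apply: (index_inj_in _ vr); rewrite memw.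
    by move: rv; clear; lia.
  have rd : desc u r d.
    apply/descP => b bu bdr; rewrite leqNgt; apply/negP => rb.
    have bh : h <= index b u by rewrite -rh.
    have br : b != r by apply/eqP => br; rewrite br ltnn in rb.
    have bd : b != d by apply/eqP => bd; move: bh dh; rewrite bd; clear; lia.
    have drh : index d u < index r u.
      rewrite ltn_neqAle -ltnS rh dh andbT; apply/eqP => /(index_inj_in du).
      by move: dr; clear; lia.
    have := av r b d ru bu du; rewrite drh => H; have := H _ isT.
    by move: bdr br bd dr rb; clear; lia.
  have ndv : ~~ desc w v d.
    apply/negP => wdv; have := B r d v ru du vu rh' (ltnW hv) rd; rewrite dr dv wdv.
    by move=> /(_ isT isT); rewrite ltnNge rmax.
  have /descPn[b] := ndv; rewrite memw => bu [bdv vb].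
  apply/descPn; exists b; rewrite ?memr //; split=> //; rewrite ord // mv blocked //.
  by move: bdv dr dv; clear; lia.
split.
- move=> y d yu du; case: (eqVneq y x) => [-> _ _|yx /(visx y yu)/(_ yx) yh dy].
    exact: lastx.
  have wdy := A y d yu du yh dy.
  rewrite leqNgt ord //; case: eqP => [_|]; first by rewrite -leqNgt.
  (* The dangerous case: [d] moves with the subtree of [x] and [y] stays. A letter [b] blocking [y]
     from [x] then lies between [d] and [y], hence does not follow [y] in [w]. This contradicts the
     second clause if [d < x], and [x < d] contradicts the third. *)
  case md: (desc w x d); last by [].
  case my: (desc w x y) => // _; exfalso.
  have /descPn[b] := negbT my; rewrite memw => bu [byx xb].
  have bdx : ~~ (minn d x <= b <= maxn d x).
    by apply/negP => /(descP _ _ _ md b); rewrite memw bu leqNgt xb => /(_ isT).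
  have xdy : ~~ (minn d y <= x <= maxn d y).
    by apply/negP => /(descP _ _ _ dy x xu); rewrite xh leqNgt yh.
  have dby : minn d y <= b <= maxn d y by move: byx bdx xdy; clear; lia.
  have wby : index b w <= index y w.
    apply: A => //; apply/descP => c cu cby; apply: (descP _ _ _ dy) => //.
    by move: cby dby; clear; lia.
  have dh : index d u < h.
    apply: leq_ltn_trans yh; apply: (descP _ _ _ dy) => //.
    by clear; lia.
  case: (ltnP d x) => dx.
    have ydx : y < d < x by move: dx xdy dby byx bdx yx; clear; lia.
    have := B y d x yu du xu yh; rewrite xh leqnn => /(_ isT dy ydx md).
    by move: wby xb; clear; lia.
  have xd : x < d by rewrite ltn_neqAle dx andbT; apply/eqP => xd; move: dh; rewrite -xd xh ltnn.
  by have := B' x d xu du; rewrite xh leqnn dh md xd => /(_ isT isT isT).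
- move=> y d v yu du vu yh hv dy ydv dv.
  have dh : index d u < h.+1.
    apply: leq_ltn_trans yh; apply: (descP _ _ _ dy) => //.
    by clear; lia.
  have vx : v != x by apply/eqP => vx; move: hv; rewrite vx xh ltnn.
  have xdv : ~~ (d <= x <= v).
    apply/negP => dxv; have := ltx v vu vx; rewrite ltnNge => /negP; apply.
    by apply: (descP _ _ _ dv); rewrite ?memr //; move: dxv; clear; lia.
  (* The new root [x] cannot lie between [d] and [v], and [right_free] excludes [x < d]. In the
     remaining case [y < d < v < x], convexity of the subtree of [x] decides. *)
  case: (ltnP x d) => xd.
    have dx : d != x by move: xd; clear; lia.
    by move: dv; rewrite (negbTE (right_free v d _ _ hv (visx d du dh dx) _)) // xd; case/andP: ydv.
  have {xd xdv} vltx : v < x by move: xd xdv vx; clear; lia.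
  have yx : y != x by move: ydv vltx; clear; lia.
  have {}yh := visx y yu yh yx.
  case wdv: (desc w v d).
    have wyv := B y d v yu du vu yh (ltnW hv) dy ydv wdv.
    rewrite ord // wyv; case: eqP => [//|]; case mv: (desc w x v); first by [].
    case my: (desc w x y) => // _.
    by rewrite (sub y v my) in mv => //; move: ydv vltx; clear; lia.
  have /descPn[b] := negbT wdv; rewrite memw => bu [bdv vb].
  have : index b (raise x w) <= index v (raise x w) by apply: (descP _ _ _ dv); rewrite ?memr.
  rewrite leqNgt !ord // vb; case mv: (desc w x v); case mb: (desc w x b) => // _.
  case my: (desc w x y) => //.
  by rewrite (sub y b my) in mb => //; move: ydv bdv vltx; clear; lia.
- move=> v d vu du hv dh vd.
  have vx : v != x by apply/eqP => vx; move: hv; rewrite vx xh ltnn.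
  (* If [x < v < d], then [u] reads [d], [x], [v] in this order, a 312 pattern. *)
  case: (leqP v x) => xv; last first.
    have dx : d != x by move: xv vd; clear; lia.
    have := av x v d xu vu du; rewrite xv vd xh (visx d du dh dx) => /(_ isT isT).
    by move: hv; clear; lia.
  case: (leqP x d) => dx.
    apply/descPn; exists x; rewrite ?memr //; split; last exact: ltx.
    by move: xv dx; clear; lia.
  have dnx : d != x by move: dx; clear; lia.
  have /descPn[b] := B' v d vu du (ltnW hv) (visx d du dh dnx) vd.
  rewrite memw => bu [bvd vb].
  apply/descPn; exists b; rewrite ?memr //; split=> //; rewrite ord // vb.
  case: eqP => //; case mb: (desc w x b) => //; case mv: (desc w x v) => // _.
  by rewrite (sub v b mv) in mb => //; move: bvd dx vd; clear; lia.
- move=> y d yu du [yh]; have -> : y = x by apply: (index_inj_in yu); rewrite yh.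
  exact: lastx.
Qed.

(** * Postfix representatives *)

(** The last letter [r] is the root and separates smaller letters from larger ones, so the word
    equals its smaller letters, then its larger ones, then [r]. Induction on the length treats both
    blocks. *)
Lemma exists_avoids312 (P : pred nat) u : all P u -> uniq u ->
  exists2 u', taig_eq P u u' & avoids312 u'.
Proof.
have [n] := ubnP (size u); elim: n u => // n IH u.
case/lastP: u => [|s r]; first by exists [::]; [exact: taig_refl|].
rewrite size_rcons ltnS => sn Pu uu.
pose m z := z < r.
have mr : m r = false by rewrite /m ltnn.
have part : taig_eq P (rcons s r) (filter m (rcons s r) ++ filter (predC m) (rcons s r)).
  apply: taig_partition => // a c au cu ma mc ca; exists r; split.
  - by rewrite mem_rcons mem_head.
  - by rewrite mr.
  - have cr : c != r.
      apply/eqP => cr; move: ca; rewrite cr; move: uu; rewrite rcons_uniq => /andP[/negbTE rs _].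
      move: au ma; rewrite mem_rcons inE => /predU1P[->|as_ _]; first by rewrite mr.
      rewrite -cats1 !index_cat rs as_ /= eqxx addn0 ltnNge index_size.
      by [].
    move: uu cu; rewrite rcons_uniq mem_rcons inE (negbTE cr) /= => /andP[/negbTE rs _] cs.
    by rewrite -cats1 !index_cat cs rs /= eqxx addn0 index_mem.
  - by move: ma mc; rewrite /m; clear; lia.
move: part; rewrite !filter_rcons /= mr /= -!cats1.
move: Pu uu; rewrite all_rcons rcons_uniq => /andP[Pr Ps] /andP[rs us].
have IHf (q : pred nat) : exists2 v, taig_eq P (filter q s) v & avoids312 v.
  apply: IH; last exact: filter_uniq.
    by apply: leq_ltn_trans sn; rewrite size_filter count_size.
  by apply/allP => z; rewrite mem_filter => /andP[_ /(allP Ps)].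
have [L eL avL] := IHf m; have [R eR avR] := IHf (predC m).
have LE (z : nat) : z \in L -> z < r by rewrite -(perm_mem (taig_perm eL)) mem_filter => /andP[].
have RE (z : nat) : z \in R -> r < z.
  rewrite -(perm_mem (taig_perm eR)) mem_filter /m /= -leqNgt => /andP[rz zs].
  by rewrite ltn_neqAle rz andbT; apply: contra rs => /eqP ->.
have Pf q : all P (filter q s).
  by apply/allP => z; rewrite mem_filter => /andP[_ /(allP Ps)].
have PL : all P L by rewrite -(perm_all _ (taig_perm eL)).
move=> part; exists (L ++ R ++ [:: r]).
  apply: taig_trans part _.
  apply: (@taig_trans _ _ (L ++ filter (predC m) s ++ [:: r])).
    by apply: taig_catr => //; rewrite all_cat Pf /= Pr.
  by apply: taig_catl => //; apply: taig_catr => //=; rewrite Pr.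
have iL (z : nat) : z \in L -> index z (L ++ R ++ [:: r]) = index z L by rewrite index_cat => ->.
have iR (z : nat) : z \in R -> index z (L ++ R ++ [:: r]) = size L + index z R.
  move=> zR; rewrite index_cat; case: ifP => [/LE|_]; first by have := RE z zR; lia.
  by rewrite index_cat zR.
have ir : index r (L ++ R ++ [:: r]) = size L + size R.
  rewrite index_cat; case: ifP => [/LE|_]; first by rewrite ltnn.
  by rewrite index_cat; case: ifP => [/RE|_]; rewrite ?ltnn //= eqxx addn0.
move=> a b c; rewrite !mem_cat !mem_seq1 => /or3P au /or3P bu /or3P cu abc.
case: cu => [cL|cR|/eqP cr]; last first.
- rewrite cr ir; case: au => [aL|aR|/eqP ->]; last by rewrite ir ltnn.
    by rewrite (iL a) // ltnNge (leq_trans (index_size a L)) ?leq_addr.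
  by rewrite (iR a) // ltn_add2l ltnNge index_size.
- rewrite (iR c) //; case: au => [aL|aR|/eqP ar].
  + by rewrite (iL a) // ltnNge (leq_trans (index_size a L)) ?leq_addr.
  + have bR : b \in R.
      case: bu => [bL|//|/eqP br]; first by have := LE b bL; have := RE a aR; move: abc; clear; lia.
      by have := RE a aR; move: abc br; clear; lia.
    by rewrite !iR // !ltn_add2l; apply: avR.
  + have bR : b \in R.
      by case: bu => [/LE|//|/eqP]; move: abc ar; clear; lia.
    by rewrite ar ir iR // !ltn_add2l !index_mem bR.
- have cr := LE c cL.
  have [ar br] : a < r /\ b < r by move: abc cr; clear; lia.
  have inL z : z < r -> [\/ z \in L, z \in R | z == r] -> z \in L.
    by move=> zr [//|/RE|/eqP zE]; move: zr; rewrite ?zE ?ltnn // => zr rz;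
      move: (ltn_trans zr rz); rewrite ltnn.
  have aL := inL a ar au; have bL := inL b br bu.
  by rewrite !iL //; apply: avL.
Qed.

(** * Distances in the cyclic shift graph and the upper bound *)

Lemma cyc_refl (P : pred nat) s t : all P t -> taig_eq P s t -> cyc P s t.
Proof. by move=> Pt st; exists [::], t; rewrite cats0; split=> //; apply: taig_refl. Qed.

Lemma cyc_perm (P : pred nat) s t : cyc P s t -> perm_eq s t.
Proof.
case=> x [y [_ _ /taig_perm sxy /taig_perm tyx]].
by apply: perm_trans sxy _; rewrite perm_catC perm_sym.
Qed.

Lemma cyc_star_perm (P : pred nat) s t : cyc_star P s t -> perm_eq s t.
Proof.
elim=> {s t} [s t|s|s t w _ st _]; first exact: cyc_perm; first by [].
exact: perm_trans.
Qed.

Lemma cyc_taigl (P : pred nat) s s' t : taig_eq P s s' -> cyc P s' t -> cyc P s t.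
Proof.
move=> ss' [x [y [Px Py s'xy tyx]]]; exists x, y; split=> //.
exact: taig_trans s'xy.
Qed.

Lemma within_taigl (P : pred nat) k s s' t : taig_eq P s s' -> within P k s' t -> within P k s t.
Proof.
case: k => [|k] /= ss'; first exact: taig_trans.
by case=> u [s'u ut]; exists u; split=> //; apply: cyc_taigl s'u.
Qed.

Lemma within_taigr (P : pred nat) k s t t' : taig_eq P t t' -> within P k s t -> within P k s t'.
Proof.
move=> tt'; elim: k s => [|k IH] s /=; first by move/taig_trans; apply.
by case=> u [su /IH ut]; exists u.
Qed.

(** [cyc] is reflexive on words over [P], so idle shifts can be put in front of a walk. *)
Lemma within_weaken (P : pred nat) k l s t : all P s -> k <= l -> within P k s t -> within P l s t.
Proof.
move=> Ps /subnK <-; elim: (l - k) => [|j IH] // /IH st.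
by exists s; split=> //; apply: cyc_refl => //; apply: taig_refl.
Qed.

Lemma within_cyc_star (P : pred nat) k s t : all P t -> within P k s t -> cyc_star P s t.
Proof.
move=> Pt; elim: k s => [|k IH] s /=.
  by move=> st; apply: rt_step; apply: cyc_refl.
by case=> u [su /IH ut]; apply: rt_trans ut; apply: rt_step.
Qed.

(** [k] counts the letters of [u] still to be raised. When none is left, the first clause of the
    invariant is the hypothesis of [taig_of_desc]. *)
Lemma within_raise (P : pred nat) e u k w : all P e -> all P u -> uniq u ->
  avoids312 u -> {subset e <= u} -> k <= size u -> perm_eq w u ->
  raise_inv u (size u - k) w -> within P k (e ++ w) (e ++ u).
Proof.
move=> Pe Pu uu av eu; elim: k w => [|k IH] w ku wu inv /=;
  have Pw : all P w by rewrite (perm_all _ wu).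
  apply: taig_catl => //; apply: taig_of_desc => // y d yu du.
  by case: inv => A _ _ _; apply: A; rewrite // subn0 index_mem.
pose x := nth 0 u (size u - k.+1).
have hu : size u - k.+1 < size u by rewrite ltn_subrL (leq_ltn_trans _ ku).
have xu : x \in u by rewrite mem_nth.
have xh : index x u = size u - k.+1 by rewrite index_uniq.
exists (e ++ raise x w); split.
  by apply: cyc_raise; rewrite ?(perm_uniq wu) // => z /eu; rewrite (perm_mem wu).
apply: IH; [exact: ltnW|exact: perm_trans (perm_raise _ _) wu|].
rewrite -subSS subSn //; exact: raise_inv_step.
Qed.

(** Both words are split into the same extra occurrences [e] followed by a repetition-free word; one
    shift per distinct letter then suffices. *)
Lemma within_support (P : pred nat) s t : all P s -> perm_eq s t ->
  within P (size (undup t)) s t.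
Proof.
move=> Ps st; have Pt : all P t by rewrite -(perm_all _ st).
have [e te] := perm_to_subseq (undup_subseq t).
have Pute : all P (undup t ++ e) by rewrite -(perm_all _ te).
have /andP[Put Pe] : all P (undup t) && all P e by rewrite -all_cat.
have et : {subset e <= t} by move=> z ze; rewrite (perm_mem te) mem_cat ze orbT.
have sut : perm_eq (undup s) (undup t).
  apply: uniq_perm; rewrite ?undup_uniq // => z.
  by rewrite !mem_undup (perm_mem st).
have [u tu av] := exists_avoids312 Put (undup_uniq t).
have utu := taig_perm tu.
have uu : uniq u by rewrite -(perm_uniq utu) undup_uniq.
have Pu : all P u by rewrite -(perm_all _ utu).
have eu : {subset e <= u} by move=> z /et; rewrite -(perm_mem utu) mem_undup.
have split_extra r : all P r -> perm_eq r t -> taig_eq P r (e ++ undup r).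
  move=> Pr rt; apply: taig_undup => //.
    apply: (perm_trans rt); apply: (perm_trans te); rewrite perm_catC perm_cat2l.
    by apply: uniq_perm; rewrite ?undup_uniq // => z; rewrite !mem_undup (perm_mem rt).
  by rewrite undup_cat_sub ?undup_uniq // => z /et; rewrite mem_undup (perm_mem rt).
apply: (within_taigl (split_extra s Ps st)).
apply: (@within_taigr _ _ _ (e ++ u)).
  apply: taig_sym; apply: (taig_trans (split_extra t Pt (perm_refl t))).
  exact: taig_catl.
rewrite (perm_size utu); apply: within_raise => //.
  exact: perm_trans utu.
(* With no letter processed, all four clauses are vacuous. *)
by rewrite subnn; split.
Qed.

Lemma same_evP s t : same_ev s t <-> perm_eq s t.
Proof. by split=> [st|/permP st a]; [apply/allP => a _; apply/eqP|]. Qed.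

(** * Descents of the inverse permutation and the lower bound *)

Definition inv_descents (n : nat) (w : seq nat) : nat :=
  \sum_(1 <= a < n) (index a.+1 w < index a w).

(** Only the comparison of [a] with [c] can change, and these are not consecutive integers. *)
Lemma inv_descents_swap n p a c r : a.+1 < c ->
  inv_descents n (p ++ [:: c, a & r]) = inv_descents n (p ++ [:: a, c & r]).
Proof.
move=> ac; apply: eq_bigr => j _; congr nat_of_bool.
rewrite !index_cat /=.
have lp z : z \in p -> index z p < size p by rewrite index_mem.
case: (boolP (j.+1 \in p)) => [/lp jp1|_]; case: (boolP (j \in p)) => [/lp jp|_];
  do ?[case: (c =P _) => ?]; do ?[case: (a =P _) => ?]; lia.
Qed.

Lemma inv_descents_taig P n s t : taig_eq P s t -> uniq s ->
  inv_descents n s = inv_descents n t.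
Proof.
elim=> {s t} //.
- move=> s t [p [q [l [r [lr _ _ -> ->]]]]].
  rewrite !cat_uniq => /and3P[_ _ /and3P[ul _ _]].
  (* Without repetitions the second family never applies, and in the first [a < b < c] gives
     [a.+1 < c]. *)
  case: lr ul => [[a [b [c [v [/and4P[_ _ _ /andP[ab bc]] _ -> ->]]]]]|[a [b [v [_ _ _ -> ->]]]]].
    rewrite /= -!catA /= !inE !mem_cat !mem_seq1 => /and3P[_ avb _].
    apply: inv_descents_swap; apply: leq_ltn_trans bc.
    by rewrite ltn_neqAle ab andbT; apply: contra avb => ->; rewrite orbT.
  by rewrite /= !inE mem_cat mem_head !orbT.
- by move=> s t st IH ut; rewrite IH // (perm_uniq (taig_perm st)).
- move=> s t w st IHs tw IHt us; rewrite IHs // IHt //.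
  by rewrite -(perm_uniq (taig_perm st)).
Qed.

(* For a repetition-free word the change caused by a shift telescopes to the end
   letters, so one shift changes the number of descents by at most one. *)
Lemma inv_descents_rot n (x y : seq nat) : 0 < n -> uniq (x ++ y) ->
  (forall a, 0 < a <= n -> a \in x ++ y) ->
  inv_descents n (y ++ x) + (n \in x) = inv_descents n (x ++ y) + (1 \in x).
Proof.
case: n => // n _ uxy; rewrite /inv_descents.
elim: n => [|n IH] mem; first by rewrite !big_geq.
rewrite !(big_nat_recr n.+1) //=.
have {}IH : inv_descents n.+1 (y ++ x) + (n.+1 \in x) = inv_descents n.+1 (x ++ y) + (1 \in x).
  by apply: IH => a /andP[a0 an]; apply: mem; rewrite a0 leqW.
(* The rotation reverses the order of [n.+1] and [n.+2] exactly if they lie in different factors. *)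
suff : (index n.+2 (y ++ x) < index n.+1 (y ++ x)) + (n.+2 \in x) =
       (index n.+2 (x ++ y) < index n.+1 (x ++ y)) + (n.+1 \in x).
  by move=> swap; rewrite -addnA swap [RHS]addnAC -IH addnA addnAC.
have disj z : z \in y -> z \in x = false.
  move: uxy; rewrite cat_uniq => /and3P[_ /hasPn xy _] zy; exact: negbTE (xy z zy).
have := mem n.+1; have := mem n.+2; rewrite !leqnn leqnSn !mem_cat => /(_ isT) m2 /(_ isT) m1.
have lx z : z \in x -> index z x < size x by rewrite index_mem.
have ly z : z \in y -> index z y < size y by rewrite index_mem.
rewrite !index_cat.
case y2: (n.+2 \in y) m2; case y1: (n.+1 \in y) m1; rewrite ?orbT ?orbF => x1 x2.
- by rewrite (disj _ y1) (disj _ y2) ltn_add2l.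
- rewrite x1 (disj _ y2) ltn_addr ?ly // ltnNge.
  by rewrite (leq_trans (index_size _ _)) ?leq_addr.
- have lt21 : index n.+2 x < size x + index n.+1 y by rewrite ltn_addr ?lx.
  rewrite x2 (disj _ y1) lt21 ltnNge.
  by rewrite (leq_trans (index_size _ _)) ?leq_addr.
- by rewrite x1 x2 ltn_add2l.
Qed.

Lemma inv_descents_within P n k s t : 0 < n -> perm_eq s (iota 1 n) ->
  within P k s t -> inv_descents n t <= inv_descents n s + k.
Proof.
move=> n0; elim: k s => [|k IH] s sn /=; have us : uniq s by rewrite (perm_uniq sn) iota_uniq.
  by move=> st; rewrite (inv_descents_taig n st) // addn0.
case=> u [su ut]; have un : perm_eq u (iota 1 n).
  by apply: perm_trans sn; rewrite perm_sym; apply: cyc_perm su.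
have := IH u un ut; case: su => x [y [_ _ sxy uyx]].
rewrite (inv_descents_taig n sxy) // (inv_descents_taig n uyx) ?(perm_uniq un) ?iota_uniq //.
have mem a : 0 < a <= n -> a \in x ++ y.
  by rewrite -(perm_mem (taig_perm sxy)) (perm_mem sn) mem_iota add1n ltnS.
have := inv_descents_rot n0 _ mem.
rewrite -(perm_uniq (taig_perm sxy)) us => /(_ isT).
by case: (1 \in x); case: (n \in x); clear; lia.
Qed.

Theorem mainTheorem5 :
  (forall s t : seq nat, all alphA s -> all alphA t ->
     (cyc_star alphA s t <-> same_ev s t))
  /\
  (forall n : nat, 1 <= n ->
     (forall s t : seq nat, all (alphAn n) s -> all (alphAn n) t ->
        cyc_star (alphAn n) s t -> within (alphAn n) n s t)
     /\
     (exists s t : seq nat, [/\ all (alphAn n) s, all (alphAn n) t,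
        cyc_star (alphAn n) s t &
        forall k, within (alphAn n) k s t -> n - 1 <= k])).
Proof.
split=> [s t Ps Pt|n n0].
  rewrite same_evP; split=> [|st]; first exact: cyc_star_perm.
  exact: within_cyc_star Pt (within_support Ps st).
(* A word over the first [n] letters has at most [n] distinct letters. *)
have upper s t : all (alphAn n) s -> all (alphAn n) t -> perm_eq s t ->
    within (alphAn n) n s t.
  move=> Ps Pt st; apply: within_weaken (within_support Ps st) => //.
  rewrite -[leqRHS](size_iota 1 n); apply: uniq_leq_size (undup_uniq t) _ => z.
  by rewrite mem_undup mem_iota add1n ltnS => /(allP Pt).
split=> [s t Ps Pt /cyc_star_perm|]; first exact: upper.
have Pn : all (alphAn n) (iota 1 n).
  by apply/allP => z; rewrite mem_iota add1n ltnS.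
have Pr : all (alphAn n) (rev (iota 1 n)) by rewrite all_rev.
have st : perm_eq (iota 1 n) (rev (iota 1 n)) by rewrite perm_sym perm_rev.
exists (iota 1 n), (rev (iota 1 n)); split=> //.
  exact: within_cyc_star Pr (upper _ _ Pn Pr st).
move=> k /(inv_descents_within n0 (perm_refl _)).
have io a : 0 < a <= n -> index a (iota 1 n) = a.-1.
  case: a => // a /= an; rewrite -[X in index X _](nth_iota 0 1 an).
  by rewrite index_uniq ?size_iota ?iota_uniq.
have ir a : 0 < a <= n -> index a (rev (iota 1 n)) = n - a.
  case: a => // a /= an.
  have na : n - a.+1 < size (rev (iota 1 n)) by rewrite size_rev size_iota; lia.
  have : nth 0 (rev (iota 1 n)) (n - a.+1) = a.+1.
    by rewrite nth_rev size_iota ?nth_iota; lia.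
  by move=> {1}<-; rewrite index_uniq // rev_uniq iota_uniq.
have -> : inv_descents n (iota 1 n) = 0.
  rewrite /inv_descents big_nat big1 // => a an; rewrite !io; lia.
have -> : inv_descents n (rev (iota 1 n)) = n - 1.
  rewrite /inv_descents big_nat (eq_bigr (fun _ => 1)).
    by rewrite -big_nat sum_nat_const_nat muln1.
  by move=> a an; rewrite !ir; lia.
by [].
Qed.
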